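(* Let $\lambda(x)=\sum_{d\ge2}\lambda_d x^{d-1}$ and $\rho(x)=\sum_{d\ge2}\rho_d x^{d-1}$ be the edge-perspective degree distributions of an arbitrary irregular LDPC code ensemble ($\lambda_d,\rho_d\ge0$, $\sum_d\lambda_d=\sum_d\rho_d=1$), let $0<\varepsilon<0.5$ be the erasure probability of the binary erasure channel and let $0<\alpha\le1$ be the missing-connection probability of the peeling decoder. Then there exists $\delta>0$ such that the asymptotic error probability $P_e^{(\infty)}$ of the peeling decoder with missing connections satisfies $$P_e^{(\infty)}>\varepsilon\,\lambda\big(1-(1-\alpha)\rho(1-\alpha)\big)>\delta>0 .$$
   Context: $\lambda_d$ (resp. $\rho_d$) is the fraction of edges of the Tanner graph connected to variable (resp. check) nodes of degree $d$. In the limit of infinite blocklength, the fraction $x_\ell$ of erased messages after $\ell$ iterations of peeling decoding over the binary erasure channel with erasure probability $\varepsilon$, when each connection between a variable node and a check node is missing independently with probability $\alpha$ (a message over a missing connection being received as an erasure), is given by the density evolution recursion $$x_0=\varepsilon,\qquad x_{\ell+1}=f_{DE}(x_\ell,\varepsilon,\alpha)=\varepsilon\,\lambda\Big(\alpha+(1-\alpha)\big(1-\rho[(1-x_\ell)(1-\alpha)]\big)\Big).$$ The asymptotic error probability is $P_e^{(\infty)}=\lim_{\ell\to\infty}x_\ell$ (the limit exists). The parameters $\lambda,\rho,\varepsilon,\alpha$ are fixed, and $\delta$ may depend on them.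
   Formalization: The strict inequality between the asymptotic error probability and the bound is stated only for α < 1; at α = 1 both sides equal ε, so the strict claim is false there and equality is stated instead; bound > δ > 0 is kept for all 0 < α ≤ 1. *)

(* Defs.v *)
From HB Require Import structures.
From mathcomp Require Import all_boot all_order all_algebra.
From mathcomp Require Import all_classical all_reals all_analysis.

Set Implicit Arguments.
Unset Strict Implicit.
Unset Printing Implicit Defensive.

Import Order.TTheory GRing.Theory Num.Theory.
Import numFieldNormedType.Exports.

Local Open Scope classical_set_scope.
Local Open Scope ring_scope.

(* A degree distribution is the sequence c : nat -> R of the fractions c d of
   edges attached to nodes of degree d.  Only the entries with d >= 2 are ever
   used, and the maximal degree is not assumed to be bounded. *)
Definition edge_degree_distribution (R : realType) (c : nat -> R) : Prop :=
  (forall d : nat, (2 <= d)%N -> 0 <= c d) /\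
  (fun n : nat => \sum_(2 <= d < n) c d) @ \oo --> (1 : R).

(* The series converges for every x in [0, 1], the only range in which it is
   evaluated. *)
Definition edge_gen (R : realType) (c : nat -> R) (x : R) : R :=
  limn (fun n : nat => \sum_(2 <= d < n) c d * x ^+ d.-1).

Definition f_DE (R : realType) (lam rho : nat -> R) (x eps alpha : R) : R :=
  eps * edge_gen lam
    (alpha + (1 - alpha) * (1 - edge_gen rho ((1 - x) * (1 - alpha)))).

Fixpoint erased_fraction (R : realType) (lam rho : nat -> R) (eps alpha : R)
    (l : nat) : R :=
  if l is l'.+1
  then f_DE lam rho (erased_fraction lam rho eps alpha l') eps alpha
  else eps.

Definition asymptotic_error (R : realType) (lam rho : nat -> R)
    (eps alpha : R) : R :=
  limn (erased_fraction lam rho eps alpha).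

(* This is f_DE at x = 0.  At alpha = 1 both this bound and the asymptotic error
   equal eps, so the bound is strict only for alpha < 1. *)
Definition error_bound (R : realType) (lam rho : nat -> R)
    (eps alpha : R) : R :=
  eps * edge_gen lam (1 - (1 - alpha) * edge_gen rho (1 - alpha)).

(* Main.v *)
Require Import Defs.
From HB Require Import structures.
From mathcomp Require Import all_boot all_order all_algebra.
From mathcomp Require Import all_classical all_reals all_analysis.
From mathcomp Require Import lra.
Import Order.TTheory GRing.Theory Num.Theory.
Import numFieldNormedType.Exports.
Local Open Scope ring_scope.

(** Write [f] for [x |-> f_DE lam rho x eps alpha] and [b = f 0] for the bound.
    Both generating functions are strictly increasing on [0, 1], hence [f] is
    nondecreasing, and strictly so when [alpha < 1].  Thus [x_l >= f 0 = b] for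
    all [l], and applying [f] once more gives [x_l >= f b] for all [l].  The
    nonincreasing sequence [x_l] therefore has a limit at least [f b > f 0 = b],
    and no continuity of [f] is needed. *)

Section EdgeGen.
Set Implicit Arguments.
Unset Strict Implicit.
Variables (R : realType) (c : nat -> R).
Hypothesis hc : edge_degree_distribution c.

Definition edge_gen_partial (x : R) : R^nat :=
  fun n => \sum_(2 <= d < n) c d * x ^+ d.-1.

Lemma nondecreasing_edge_gen_partial (x : R) : 0 <= x ->
  nondecreasing_seq (edge_gen_partial x).
Proof.
move=> x0; apply/nondecreasing_seqP => n; rewrite /edge_gen_partial.
case: (leqP 2 n) => [n2|n2]; last by rewrite !big_geq// ltnW.
by rewrite big_nat_recr//= lerDl mulr_ge0 ?exprn_ge0// hc.1.
Qed.

Lemma edge_gen_partial1 : edge_gen_partial 1 = (fun n => \sum_(2 <= d < n) c d).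
Proof.
by apply/funext => n; apply: eq_bigr => d _; rewrite expr1n mulr1.
Qed.

Lemma edge_gen1 : edge_gen c 1 = 1.
Proof.
apply: cvg_lim => //; rewrite -/(edge_gen_partial 1) edge_gen_partial1.
exact: hc.2.
Qed.

Lemma edge_gen_partial_le (x y : R) n : 0 <= x -> x <= y ->
  edge_gen_partial x n <= edge_gen_partial y n.
Proof.
move=> x0 xy; apply: ler_sum_nat => d /andP[d2 _].
by rewrite ler_wpM2l ?hc.1// lerXn2r// nnegrE// (le_trans x0).
Qed.

(** Monotone convergence: the partial sums at [x] are dominated by those at 1, which increase to
    1. *)
Lemma is_cvg_edge_gen (x : R) : 0 <= x -> x <= 1 -> cvgn (edge_gen_partial x).
Proof.
move=> x0 x1; apply: nondecreasing_is_cvgn.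
  exact: nondecreasing_edge_gen_partial.
exists 1 => _ [n _ <-]; apply: (le_trans (edge_gen_partial_le n x0 x1)).
rewrite -[leRHS]edge_gen1; apply: nondecreasing_cvgn_le.
  exact: nondecreasing_edge_gen_partial.
by apply/cvg_ex; exists 1; rewrite edge_gen_partial1; exact: hc.2.
Qed.

Lemma edge_gen_ge0 (x : R) : 0 <= x -> x <= 1 -> 0 <= edge_gen c x.
Proof.
move=> x0 x1; have := nondecreasing_cvgn_le
  (nondecreasing_edge_gen_partial x0) (is_cvg_edge_gen x0 x1) 0.
by rewrite {1}/edge_gen_partial big_geq.
Qed.

(** Otherwise every partial sum at 1 would vanish, against [edge_gen1]. This coefficient is the
    source of all strict inequalities below. *)
Lemma edge_degree_distribution_pos : exists2 d, (2 <= d)%N & 0 < c d.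
Proof.
apply: contrapT => npos.
have c0 d : (2 <= d)%N -> c d = 0.
  move=> d2; apply/eqP/negPn/negP => cd0; apply: npos; exists d => //.
  by rewrite lt_def cd0 hc.1.
have : edge_gen c 1 = 0.
  rewrite /edge_gen (_ : (fun _ => _) = cst 0) ?lim_cst//.
  apply/funext => n; rewrite big_nat_cond big1// => d /andP[/andP[d2 _] _].
  by rewrite c0// mul0r.
by rewrite edge_gen1 => /eqP; rewrite oner_eq0.
Qed.

(** A strict inequality between partial sums may be lost in the limit. A single term with [0 < c d]
    gives a gap that does not depend on [n], and this gap survives. *)
Lemma edge_gen_lt (x y : R) : 0 <= x -> x < y -> y <= 1 ->
  edge_gen c x < edge_gen c y.
Proof.
move=> x0 xy y1; have [d d2 cd0] := edge_degree_distribution_pos.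
have y0 : 0 <= y by rewrite (le_trans x0)// ltW.
have cx := is_cvg_edge_gen x0 (le_trans (ltW xy) y1).
have cy := is_cvg_edge_gen y0 y1.
(* Since [2 <= d], the exponent [d.-1] is nonzero and the power is strictly increasing. *)
have gap0 : 0 < c d * (y ^+ d.-1 - x ^+ d.-1).
  by rewrite mulr_gt0// subr_gt0 ltrXn2r// -lt0n -ltnS prednK// ltnW.
have gap_le n : (d < n)%N ->
    c d * (y ^+ d.-1 - x ^+ d.-1) <=
    edge_gen_partial y n - edge_gen_partial x n.
  move=> dn; rewrite /edge_gen_partial -sumrB.
  rewrite (bigD1_seq d)/= ?iota_uniq//; last first.
    by rewrite mem_index_iota d2.
  rewrite -mulrBr lerDl big_seq_cond sumr_ge0// => k.
  rewrite mem_index_iota => /andP[/andP[k2 _] _].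
  by rewrite -mulrBr mulr_ge0 ?hc.1// subr_ge0 lerXn2r// ?nnegrE// ltW.
rewrite -subr_gt0 (lt_le_trans gap0)// /edge_gen -limB//.
apply: limr_ge; first exact: is_cvgB.
by exists d.+1 => // n /= dn; exact: gap_le.
Qed.

Lemma edge_gen_le (x y : R) : 0 <= x -> x <= y -> y <= 1 ->
  edge_gen c x <= edge_gen c y.
Proof.
move=> x0; rewrite le_eqVlt => /predU1P[->//|xy] y1.
exact/ltW/edge_gen_lt.
Qed.

Lemma edge_gen_le1 (x : R) : 0 <= x -> x <= 1 -> edge_gen c x <= 1.
Proof. by move=> x0 x1; rewrite -[leRHS]edge_gen1 edge_gen_le. Qed.

Lemma edge_gen_gt0 (x : R) : 0 < x -> x <= 1 -> 0 < edge_gen c x.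
Proof.
by move=> x0 x1; rewrite (le_lt_trans _ (edge_gen_lt _ x0 x1)) ?edge_gen_ge0.
Qed.

End EdgeGen.

Section DensityEvolution.
Set Implicit Arguments.
Unset Strict Implicit.
Variables (R : realType) (lam rho : nat -> R) (eps alpha : R).
Hypotheses (hlam : edge_degree_distribution lam)
  (hrho : edge_degree_distribution rho).
Hypotheses (heps0 : 0 < eps) (heps1 : eps <= 1).
Hypotheses (halpha0 : 0 < alpha) (halpha1 : alpha <= 1).

Local Notation f x := (f_DE lam rho x eps alpha).
Local Notation x_ := (erased_fraction lam rho eps alpha).
Local Notation erasure_arg x :=
  (alpha + (1 - alpha) * (1 - edge_gen rho ((1 - x) * (1 - alpha)))).

Lemma check_arg_itv (x : R) : 0 <= x -> x <= 1 ->
  0 <= (1 - x) * (1 - alpha) <= 1.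
Proof.
move=> x0 x1.
by rewrite mulr_ge0 ?mulr_ile1 ?subr_ge0 ?gerBl// ltW.
Qed.

(** The argument is a convex combination of 1 and a number in [0, 1], with weight [alpha > 0] on
    1. *)
Lemma erasure_arg_itv (x : R) : 0 <= x -> x <= 1 -> 0 < erasure_arg x <= 1.
Proof.
move=> x0 x1; have /andP[u0 u1] := check_arg_itv x0 x1.
have r0 := edge_gen_ge0 hrho u0 u1; have r1 := edge_gen_le1 hrho u0 u1.
move: r0 r1; set r := edge_gen _ _ => r0 r1.
have a0 := halpha0; have a1 : 0 <= 1 - alpha by rewrite subr_ge0.
have ar0 := mulr_ge0 a1 r0.
have ar1 : 0 <= (1 - alpha) * (1 - r) by rewrite mulr_ge0// subr_ge0.
by apply/andP; split; lra.
Qed.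

Lemma error_boundE : error_bound lam rho eps alpha = f 0.
Proof.
by rewrite /error_bound /f_DE subr0 mul1r; congr (_ * edge_gen _ _); lra.
Qed.

Lemma f_DE_gt0 (x : R) : 0 <= x -> x <= 1 -> 0 < f x.
Proof.
move=> x0 x1; have /andP[v0 v1] := erasure_arg_itv x0 x1.
by rewrite mulr_gt0// edge_gen_gt0.
Qed.

Lemma f_DE_le_eps (x : R) : 0 <= x -> x <= 1 -> f x <= eps.
Proof.
move=> x0 x1; have /andP[v0 v1] := erasure_arg_itv x0 x1.
by rewrite ler_piMr ?edge_gen_le1// ltW.
Qed.

(** Two order reversals, [1 - x] and [1 - edge_gen rho _], cancel. Both factors [1 - alpha] must be
    positive to keep the inequality strict. *)
Lemma f_DE_lt (x y : R) : alpha < 1 -> 0 <= x -> x < y -> y <= 1 -> f x < f y.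
Proof.
move=> a1 x0 xy y1.
have x1 : x <= 1 by lra.
have y0 : 0 <= y by lra.
have /andP[ux0 ux1] := check_arg_itv x0 x1.
have /andP[uy0 uy1] := check_arg_itv y0 y1.
have /andP[vx0 _] := erasure_arg_itv x0 x1.
have /andP[_ vy1] := erasure_arg_itv y0 y1.
rewrite ltr_pM2l// edge_gen_lt// ?(ltW vx0)//.
rewrite ltrD2l ltr_pM2l ?subr_gt0// ltrD2l ltrN2 edge_gen_lt//.
by rewrite ltr_pM2r ?subr_gt0// ltrD2l ltrN2.
Qed.

Lemma f_DE_alpha1 (x : R) : alpha = 1 -> f x = eps.
Proof. by move=> ->; rewrite /f_DE subrr mul0r addr0 edge_gen1// mulr1. Qed.

Lemma f_DE_le (x y : R) : 0 <= x -> x <= y -> y <= 1 -> f x <= f y.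
Proof.
move=> x0; rewrite le_eqVlt => /predU1P[->//|xy] y1.
(* At [alpha = 1] the map is constant, so [f_DE_lt] fails there but the weak inequality holds. *)
move: halpha1; rewrite le_eqVlt => /predU1P[a1|a1].
  by rewrite !f_DE_alpha1.
exact/ltW/f_DE_lt.
Qed.

Lemma erased_fraction_itv l : 0 < x_ l <= eps.
Proof.
elim: l => [|l /andP[l0 leps]] /=; first by rewrite heps0 lexx.
have l1 := le_trans leps heps1.
by rewrite f_DE_gt0 ?f_DE_le_eps// ltW.
Qed.

Lemma nonincreasing_erased_fraction : nonincreasing_seq x_.
Proof.
have itv l : 0 <= x_ l /\ x_ l <= 1.
  have /andP[/ltW ? /le_trans le1] := erased_fraction_itv l.
  by split; last exact: le1.
apply/nonincreasing_seqP => l; elim: l => [|l IH].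
  (* The base case is [x_ 1 <= eps], and [eps] is [x_ 0]; monotonicity of [f] then carries the
     comparison along the recursion. *)
  by have /andP[] := erased_fraction_itv 1.
have [[_ ?] [? _]] := (itv l, itv l.+1).
by rewrite [leLHS]/= [leRHS]/=; exact: f_DE_le.
Qed.

Lemma is_cvg_erased_fraction : cvgn x_.
Proof.
apply: nonincreasing_is_cvgn; first exact: nonincreasing_erased_fraction.
by exists 0 => _ [l _ <-]; have /andP[/ltW] := erased_fraction_itv l.
Qed.

(** One application of [f] turns a uniform lower bound into another one: [x_ l.+1] is [f (x_ l)],
    and [x_ 0 = eps] dominates every value of [f]. *)
Lemma f_DE_le_erased_fraction (y : R) : 0 <= y -> (forall l, y <= x_ l) ->
  forall l, f y <= x_ l.
Proof.
move=> y0 yx; have y1 : y <= 1 := le_trans (yx 0%N) heps1.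
case=> [|l] /=; first exact: f_DE_le_eps.
have /andP[_ /le_trans le1] := erased_fraction_itv l.
by apply: f_DE_le => //; exact: le1.
Qed.

End DensityEvolution.

Theorem lemma2 (R : realType) (lam rho : nat -> R) (eps alpha : R)
    (hlam : edge_degree_distribution lam)
    (hrho : edge_degree_distribution rho)
    (heps0 : 0 < eps) (heps : eps < 2^-1)
    (halpha0 : 0 < alpha) (halpha1 : alpha <= 1) :
  exists delta : R,
    [/\ alpha < 1 ->
          error_bound lam rho eps alpha < asymptotic_error lam rho eps alpha,
        alpha = 1 ->
          asymptotic_error lam rho eps alpha = error_bound lam rho eps alpha,
        delta < error_bound lam rho eps alpha
      & 0 < delta].
Proof.
have eps1 : eps <= 1 by lra.
have b0 : 0 < f_DE lam rho 0 eps alpha by exact: f_DE_gt0.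
(* Any number strictly between 0 and the positive bound would do; half of the bound is taken. *)
exists (error_bound lam rho eps alpha / 2); rewrite error_boundE.
split; [move=> a1|move=> a1|lra|lra].
- set b := f_DE lam rho 0 eps alpha.
  have b1 : b <= 1 by apply: le_trans eps1; exact: f_DE_le_eps.
  (* First use of the improvement lemma, from the trivial lower bound 0; the second use, from [b],
     bounds the limit below by [f b]. *)
  have xb : forall l, b <= erased_fraction lam rho eps alpha l.
    apply: f_DE_le_erased_fraction => // l.
    have itv := erased_fraction_itv hlam hrho heps0 eps1 halpha0 halpha1 l.
    by have /andP[/ltW] := itv.
  have bfb : b < f_DE lam rho b eps alpha by exact: f_DE_lt.
  apply: (lt_le_trans bfb); apply: limr_ge; first exact: is_cvg_erased_fraction.
  by apply: nearW; apply: f_DE_le_erased_fraction => //; exact: ltW.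
- rewrite f_DE_alpha1// /asymptotic_error.
  (* With all connections missing, the recursion never leaves its initial value [eps]. *)
  rewrite (_ : erased_fraction _ _ _ _ = cst eps) ?lim_cst//.
  by apply/funext => -[|l] //=; rewrite f_DE_alpha1.
Qed.
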